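(* Let $k\ge 2$ and $n\ge 2k-3$ be integers and let $P=U^{k-1}D^{k-1}UD$. The number $d_n(P)$ of Dyck paths of semilength $n$ avoiding the pattern $P$ is $$d_n(P)=\binom{n-1}{k-2}C_{k-1}-\sum_{s=2}^{k-2}b_{k-2,s}\cdot\left(\sum_{i=0}^{s-2}b_{k-3-i,\,s-2-i}\binom{n-k-s+3+2i}{i}\right),$$ where $C_{k-1}$ is the $(k-1)$-th Catalan number, $b_{i,j}$ are the ballot numbers, and the outer sum is empty (equal to $0$) when $k<4$.
   Context: A Dyck path of semilength $n$ is a word of length $2n$ on the alphabet $\{U,D\}$ with $n$ letters $U$ and $n$ letters $D$ in which every prefix contains at least as many $U$'s as $D$'s. A Dyck path $Q$ contains the pattern $P$ (another Dyck path) if $P$ is a (not necessarily contiguous) subword, i.e. subsequence, of $Q$; otherwise $Q$ avoids $P$. A Dyck prefix is a word on $\{U,D\}$ all of whose prefixes contain at least as many $U$'s as $D$'s. For $0\le j\le i$, the ballot number $b_{i,j}$ is the number of Dyck prefixes with exactly $i$ letters $U$ and $j$ letters $D$. The Catalan numbers are $C_m=\frac{1}{m+1}\binom{2m}{m}$. *)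

(* Defs.v *)
From mathcomp Require Import all_boot all_order all_algebra.

Set Implicit Arguments.
Unset Strict Implicit.
Unset Printing Implicit Defensive.

(* Words on the alphabet {U, D} are sequences of booleans. *)
Definition U : bool := true.
Definition D : bool := false.

Definition dyck_prefix (w : seq bool) : bool :=
  [forall i : 'I_(size w).+1,
     count_mem D (take i w) <= count_mem U (take i w)].

Definition dyck_path (n : nat) (w : seq bool) : bool :=
  [&& dyck_prefix w, count_mem U w == n & count_mem D w == n].

(* A pattern is a subword with not necessarily contiguous letters, which is
   [subseq] (whereas [infix] would mean contiguous). *)
Definition avoids (P Q : seq bool) : bool := ~~ subseq P Q.

Definition num_avoiding (n : nat) (P : seq bool) : nat :=
  #|[set w : (2 * n).-tuple bool | dyck_path n w && avoids P w]|.

Definition ballot (i j : nat) : nat :=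
  #|[set w : (i + j).-tuple bool |
      [&& dyck_prefix w, count_mem U w == i & count_mem D w == j]]|.

Definition catalan (m : nat) : nat := 'C(2 * m, m) %/ m.+1.

(* The Euclidean quotient in [catalan] is exact. *)
Lemma catalanE (m : nat) : m.+1 * catalan m = 'C(2 * m, m).
Proof.
rewrite /catalan mulnC divnK //.
have H : m.+1 * 'C(2 * m, m.+1) = m * 'C(2 * m, m).
  by rewrite mul_bin_left mulSn mul1n addnK.
by rewrite -(@Gauss_dvdr _ m) ?coprimeSn // -H dvdn_mulr.
Qed.

Definition pattern (k : nat) : seq bool :=
  nseq (k - 1) U ++ nseq (k - 1) D ++ [:: U; D].

(* Main.v *)
Require Import Defs.
From mathcomp Require Import all_boot all_order all_algebra.
From mathcomp Require Import zify.

(** A word contains U^(k-1) D^(k-1) U D iff it does so greedily: a Dyck path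
    avoids the pattern iff all its U's occur before the (k-1)-th D that follows
    the (k-1)-th U.  If s letters D precede the (k-1)-th U, the path is thus a
    Dyck prefix with k-2 U's and s D's, a letter U, and an arrangement of the
    remaining n-k+1 U's and of k-2 D's that does not go below 0 from height
    k-1-s; the last D's are then forced.  There are C(n-1, k-2) arrangements,
    and those which do go below 0 are classified by their first passage to -1,
    which is a reversed Dyck prefix followed by a D.  The sum over s of the
    ballot numbers b_(k-2,s) is C_(k-1). *)

Local Open Scope nat_scope.

(** * Enumeration of words of given length *)

Fixpoint words (m : nat) : seq (seq bool) :=
  if m is m'.+1 then map (cons U) (words m') ++ map (cons D) (words m')
  else [:: [::]].

Lemma mem_words m w : (w \in words m) = (size w == m).
Proof.
elim: m w => [|m IHm] [|x w] //=.
  by rewrite mem_cat; apply/negbTE/norP; split; apply/mapP => -[].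
rewrite mem_cat eqSS -IHm; apply/orP/idP => [[] /mapP[v Hv [_ ->]] //|Hw].
by case: x; [left | right]; apply: map_f.
Qed.

Lemma uniq_words m : uniq (words m).
Proof.
have cons_injr (x : bool) : injective (cons x) by move=> ? ? [].
elim: m => //= m IHm; rewrite cat_uniq !map_inj_uniq ?IHm //.
rewrite andbT; apply/hasPn => _ /mapP[v _ ->]; apply/negP.
by case/mapP.
Qed.

(** Moves from sets of tuples to an explicit list, where splitting by the first letter is a
    computation. *)
Lemma card_words m (P : pred (seq bool)) :
  #|[set w : m.-tuple bool | P w]| = count P (words m).
Proof.
rewrite cardsE cardE size_filter -enumT -(count_map val P).
apply: (permP _ P); apply: uniq_perm; 
  rewrite ?uniq_words ?(map_inj_uniq val_inj) ?enum_uniq //.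
move=> w; rewrite mem_words; apply/mapP/idP => [[t _ ->]|Hw].
  by rewrite size_tuple.
by exists (Tuple Hw); rewrite ?mem_enum.
Qed.

Lemma perm_words_rcons m :
  perm_eq (words m.+1)
    (map (rcons^~ U) (words m) ++ map (rcons^~ D) (words m)).
Proof.
apply: uniq_perm; first exact: uniq_words.
  rewrite cat_uniq !map_inj_uniq ?uniq_words; try exact: rcons_injl.
  rewrite andbT; apply/hasPn => _ /mapP[v _ ->]; apply/negP.
  by case/mapP => v' _ /rcons_inj[].
move=> w; rewrite mem_words mem_cat.
case/lastP: w => [|w x].
  by apply/esym/negbTE/norP; split; apply/mapP => -[[]].
rewrite size_rcons eqSS -mem_words; apply/idP/orP => [Hw|].
  by case: x; [left | right]; apply/mapP; exists w.
by case=> /mapP[v Hv /rcons_inj[-> _]].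
Qed.

(** * Walks above the axis from an arbitrary height *)

Fixpoint stays (h : nat) (w : seq bool) : bool :=
  if w is x :: w' then
    if x then stays h.+1 w' else if h is h'.+1 then stays h' w' else false
  else true.

Lemma staysP h w :
  reflect (forall i, count_mem D (take i w) <= h + count_mem U (take i w))
          (stays h w).
Proof.
elim: w h => [|[] w IHw] h /=; first by left.
- apply: (iffP (IHw _)) => H i; last by have := H i.+1; rewrite /U /D /=; lia.
  by case: i => [|i] //=; have := H i; rewrite /U /D /=; lia.
- case: h => [|h]; first by right=> /(_ 1) /=; rewrite take0.
  apply: (iffP (IHw _)) => H i; last by have := H i.+1; rewrite /U /D /=; lia.
  by case: i => [|i] //=; have := H i; rewrite /U /D /=; lia.
Qed.

Lemma dyck_prefixE w : dyck_prefix w = stays 0 w.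
Proof.
apply/forallP/staysP => H i; last exact: H.
case: (ltnP i (size w).+1) => [lt_i|/ltnW le_i]; first exact: H (Ordinal lt_i).
by have := H ord_max; rewrite /= take_size (take_oversize le_i).
Qed.

Lemma stays_rcons h w x :
  stays h (rcons w x) =
  stays h w && (count_mem D (rcons w x) <= h + count_mem U (rcons w x)).
Proof.
apply/staysP/andP => [H|[/staysP H1 H2] i].
  split; last by have := H (size w).+1; rewrite take_oversize ?size_rcons.
  apply/staysP => i; case: (leqP i (size w)) => Hi.
    by have := H i; rewrite -cats1 takel_cat.
  have := H (size w); rewrite -cats1 take_size_cat //.
  by rewrite take_oversize // ltnW.
case: (leqP i (size w)) => Hi; first by rewrite -cats1 takel_cat.
by rewrite take_oversize ?size_rcons.
Qed.

(** The predicate [P] is arbitrary so that a removed first letter can be absorbed into it, as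
    [fun w => P (U :: w)]. *)
Definition walks (P : pred (seq bool)) (h u d : nat) : nat :=
  count (fun w => [&& stays h w, count_mem U w == u, count_mem D w == d & P w])
        (words (u + d)).

Lemma walks_eq0 P h u d :
  (forall w, count_mem U w = u -> count_mem D w = d -> ~~ P w) ->
  walks P h u d = 0.
Proof.
move=> H; apply/eqP; rewrite -leqn0 leqNgt -has_count; apply/hasPn => w _.
by apply/and4P => -[_ /eqP Hu /eqP Hd]; apply/negP/H.
Qed.

Lemma ballotE i j : ballot i j = walks predT 0 i j.
Proof.
rewrite /ballot (card_words _ (fun w =>
  [&& dyck_prefix w, count_mem U w == i & count_mem D w == j])).
by apply: eq_count => w; rewrite dyck_prefixE andbT.
Qed.

Lemma num_avoidingE n P : num_avoiding n P = walks (avoids P) 0 n n.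
Proof.
rewrite /num_avoiding (card_words _ (fun w => dyck_path n w && avoids P w)).
rewrite mul2n -addnn.
by apply: eq_count => w; rewrite /dyck_path dyck_prefixE -!andbA.
Qed.

Lemma walks_SS P h u d :
  walks P h u.+1 d.+1 =
  walks (fun w => P (U :: w)) h.+1 u d.+1 +
  (if h is h'.+1 then walks (fun w => P (D :: w)) h' u.+1 d else 0).
Proof.
rewrite /walks addSn /= count_cat !count_map; congr (_ + _).
rewrite -addSnnS; case: h => [|h]; last by apply: eq_count.
by rewrite (eq_count (a2 := pred0)) ?count_pred0.
Qed.

Lemma walks_0d P h d : walks P h 0 d = (d <= h) && P (nseq d D) :> nat.
Proof.
elim: d h P => [|d IHd] h P; first by rewrite /walks /= addn0.
rewrite /walks /= count_cat !count_map.
rewrite (eq_count (a2 := pred0)) ?count_pred0; last first.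
  by move=> w /=; rewrite andbF.
case: h => [|h].
  by rewrite add0n ltn0 (eq_count (a2 := pred0)) ?count_pred0.
by rewrite -(IHd h (fun w => P (D :: w))).
Qed.

Lemma walks_u0 P h u : walks P h u 0 = P (nseq u U).
Proof.
elim: u h P => [|u IHu] h P; first by rewrite /walks /= addn0.
rewrite /walks addn0 /= count_cat !count_map.
rewrite [X in _ + X](eq_count (a2 := pred0)) ?count_pred0; last first.
  by move=> w /=; rewrite !andbF.
by rewrite addn0 -(IHu h.+1 (fun w => P (U :: w))) /walks addn0.
Qed.

Local Notation nwalks := (walks predT).

Lemma nwalks_S0S h d : nwalks h.+1 0 d.+1 = nwalks h 0 d.
Proof. by rewrite !walks_0d. Qed.

Lemma nwalks_0SS u d : nwalks 0 u.+1 d = nwalks 1 u d.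
Proof. by case: d => [|d]; rewrite ?walks_u0 // walks_SS addn0. Qed.

Lemma nwalks_SSS h u d :
  nwalks h.+1 u.+1 d.+1 = nwalks h.+2 u d.+1 + nwalks h u.+1 d.
Proof. by rewrite walks_SS. Qed.

(** * Ballot numbers and first passages *)

Lemma ballot_u0 u : ballot u 0 = 1.
Proof. by rewrite ballotE walks_u0. Qed.

Lemma ballot_lt u d : u < d -> ballot u d = 0.
Proof.
move=> lt_ud; rewrite ballotE /walks; apply/eqP.
rewrite -leqn0 leqNgt -has_count; apply/hasPn => w _; apply/and4P.
case=> /staysP/(_ (size w)) + /eqP Hu /eqP Hd _.
by rewrite take_size Hu Hd leqNgt lt_ud.
Qed.

(** Remove the last letter: [d <= u] makes the final height nonnegative, so only the shorter
    prefixes constrain the word. *)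
Lemma ballot_SS u d :
  d <= u -> ballot u.+1 d.+1 = ballot u d.+1 + ballot u.+1 d.
Proof.
move=> le_du; rewrite !ballotE /walks [u.+1 + _]addSn.
rewrite (permP (perm_words_rcons _)) count_cat !count_map -addSnnS.
congr (_ + _); rewrite 1?addSnnS; apply: eq_count => w /=;
  rewrite stays_rcons -cats1 !count_cat /U /D /=; case: (stays 0 w) => //=;
  move: (count _ w) (count _ w) => a b; lia.
Qed.

(** The reflection formula, written without subtraction. The case [d = u], where the ballot number
    is 0 and the binomials agree by symmetry, feeds the induction. *)
Lemma ballotD u d :
  d <= u -> ballot u d.+1 + 'C(u + d.+1, d) = 'C(u + d.+1, d.+1).
Proof.
elim: u d => [|u IHu] d.
  by rewrite leqn0 => /eqP->; rewrite ballot_lt.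
elim: d => [|d IHd] le_du.
  by have := IHu 0 isT; rewrite ballot_SS // ballot_u0 !bin0 !bin1; lia.
rewrite leq_eqVlt eqSS in le_du; case/predU1P: le_du => [->|lt_du].
  rewrite ballot_lt // add0n -bin_sub; last by lia.
  by congr 'C(_, _); lia.
rewrite ltnS in lt_du.
rewrite ballot_SS //; have := IHu _ lt_du; have := IHd (leqW (ltnW lt_du)).
by rewrite [u.+1 + d.+1]addSnnS [u.+1 + d.+2]addSn !binS; lia.
Qed.

Lemma sum_ballot m k : k <= m -> \sum_(s < k.+1) ballot m s = ballot m.+1 k.
Proof.
elim: k => [|k IHk] le_km; first by rewrite big_ord1 !ballot_u0.
by rewrite big_ord_recr /= IHk 1?ltnW // ballot_SS 1?ltnW // addnC.
Qed.

Lemma ballot_catalan m : ballot m.+1 m = catalan m.+1.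
Proof.
apply/eqP; rewrite -(eqn_pmul2l (ltn0Sn m.+1)) catalanE; apply/eqP.
case: m => [|m]; first by rewrite ballot_u0.
have := ballotD _ _ (leqW (leqnSn m)).
have -> : 2 * m.+2 = (m.+2 + m.+1).+1 by lia.
set N := m.+2 + m.+1.
have := mul_bin_left N m; have -> : N - m = m.+3 by lia.
have := @bin_sub N m.+1; have -> : N - m.+1 = m.+2 by lia.
rewrite [X in _ -> _ -> _ -> _ = X]binS => ->; last by lia.
nia.
Qed.

(* The number of ways to complete, to a word with u U's and d D's, a first
   passage from height h to -1 that uses j U's and h + j + 1 D's. *)
Definition completions (h u d j : nat) : nat :=
  (h + j < d) * 'C(u + d - (h + j + j).+1, u - j).

Lemma completionsU h u d j : completions h u.+1 d j.+1 = completions h.+1 u d j.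
Proof. by rewrite /completions !addnS !addSn !subSS. Qed.

Lemma completionsD h u d j : completions h.+1 u d.+1 j = completions h u d j.
Proof. by rewrite /completions !addnS !addSn !subSS. Qed.

(** A first passage with [j] letters U, stripped of its last D, is a Dyck prefix when read backwards
    with U and D exchanged; hence [ballot (h + j) j]. The induction matches Pascal's rule with
    [ballot_SS], both splitting by the first letter of the walk. *)
Lemma bin_nwalks h u d :
  'C(u + d, u) =
  nwalks h u d + \sum_(j < u.+1) ballot (h + j) j * completions h u d j.
Proof.
elim: u h d => [|u IHu] h d.
  rewrite walks_0d bin0 big_ord1 addn0 ballot_u0 /completions addn0 bin0 andbT.
  by case: leqP.
elim: d h => [|d IHd] h.
  rewrite walks_u0 addn0 binn big1 // => j _.
  by rewrite /completions ltn0 muln0.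
rewrite [in LHS]addSn binS (IHu h.+1) walks_SS.
rewrite [in RHS]big_ord_recl /= ballot_u0 mul1n.
under [in RHS]eq_bigr => j _ do rewrite /bump leq0n add1n completionsU.
case: h => [|h].
  (* From height 0 a leading D is itself the first passage ([j = 0]), and what follows it is
     arbitrary. *)
  rewrite {2}/completions subn0 addSn subSS !addn0 mul1n subn0 addnCA.
  congr (_ + (_ + _)).
  by apply: eq_bigr => j _; rewrite add0n ballot_SS ?(ballot_lt j j.+1).
under [in RHS]eq_bigr => j _.
  have le_jhj : j <= h + j.+1 by rewrite addnS leqW ?leq_addl.
  rewrite (ballot_SS _ _ le_jhj) mulnDl.
  rewrite -[in X in X + _]completionsU completionsD.
  rewrite -[(h + j.+1).+1]addSn -[h.+1 + j.+1]addSnnS.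
  over.
rewrite big_split /= completionsD -addSnnS (IHd h).
rewrite big_ord_recl /= ballot_u0 mul1n.
under [in LHS]eq_bigr => j _ do rewrite /bump leq0n add1n.
by rewrite addnACA [X in X + _ = _]addnC !addnA.
Qed.

(** * Greedy matching of the pattern *)

(** With [h] more D's than U's the walk ends at height 0, a property that removing the first letter
    preserves. *)
Lemma walks_step P h u :
  walks P h u.+1 (h + u.+1) =
  walks (fun w => P (U :: w)) h.+1 u (h.+1 + u) +
  (if h is h'.+1 then walks (fun w => P (D :: w)) h' u.+1 (h' + u.+1) else 0).
Proof.
rewrite addnS walks_SS; case: h => [|h] //.
by congr (_ + _); rewrite -addSnnS.
Qed.

(* s is the number of D's before the (r+1)-st U. *)
Lemma walks_avoid_nseqU P h r u :
  walks (avoids (nseq r.+1 U ++ P)) h (u + r.+1) (h + (u + r.+1)) =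
  \sum_(s < (h + r).+1) nwalks h r s *
    walks (avoids P) (h + r.+1 - s) u (h + r.+1 - s + u).
Proof.
elim: r h u => [|r IHr] h u.
  (* [subseq] is greedy by definition, so the predicates produced by [walks_step] reduce by
     computation to avoidance of what remains of the pattern. *)
  rewrite !addn1 addn0 /=; elim: h => [|h IHh].
    by rewrite walks_step addn0 big_ord1 walks_u0 mul1n subn0.
  rewrite walks_step IHh [RHS]big_ord_recl walks_u0 mul1n subn0; congr (_ + _).
  by apply: eq_bigr => s _; rewrite lift0 nwalks_S0S subSS.
rewrite addnS; elim: h => [|h IHh].
  rewrite walks_step addn0 IHr; apply: eq_bigr => s _.
  by rewrite nwalks_0SS.
rewrite walks_step IHh IHr (addSnnS h.+1 r) (addSn h r.+1).
rewrite big_ord_recl [in RHS]big_ord_recl /= !walks_u0 !mul1n.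
rewrite -addnA -big_split /= (addSnnS h.+1 r.+1); congr (_ + _).
apply: eq_bigr => s _; rewrite /bump leq0n add1n nwalks_SSS mulnDl.
by rewrite (addSn h r.+2) subSS.
Qed.

(* Only c D's may occur before the last U, and [h + u >= c] makes room for
   padding to exactly c D's with those that follow it. *)
Lemma walks_avoid_nseqD c h u :
  c <= h + u ->
  walks (avoids (nseq c.+1 D ++ [:: U; D])) h u (h + u) = nwalks h u c.
Proof.
have no_D g v d : walks (avoids [:: D]) g v d.+1 = 0.
  apply: walks_eq0 => w _ Hd; rewrite /avoids negbK sub1seq.
  by rewrite -has_pred1 has_count Hd.
(* A walk that ends at height 0 has a D after each U. *)
have no_UD g v : walks (avoids [:: U; D]) g v.+1 (g + v.+1) = 0.
  by elim: g => [|g IHg]; rewrite walks_step [X in X + _]no_D ?IHg.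
elim: u c h => [|u IHu] c h.
  rewrite addn0 !walks_0d leqnn => -> /=.
  apply/esym; rewrite /avoids; case: subseqP => // -[m _ Hm].
  have: U \in nseq h D.
    rewrite (mem_mask (m := m)) // -Hm.
    by rewrite inE mem_cat !inE eqxx !orbT.
  by rewrite mem_nseq andbF.
elim: h c => [|h IHh] [|c] le_c; rewrite walks_step.
- by rewrite addn0 [LHS]IHu // !walks_u0.
- by rewrite addn0 [LHS]IHu // nwalks_0SS.
(* A leading D completes the run of D's in the pattern, leaving only UD to avoid, which is
   impossible while a U remains. *)
- by rewrite [X in _ + X]no_UD addn0 [LHS]IHu // !walks_u0.
- rewrite [X in X + _]IHu; last by rewrite addSnnS.
  by rewrite [X in _ + X]IHh ?nwalks_SSS.
Qed.

(** * Assembling the formula *)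

(** Here [r] is k-2 and [u] is n-k+1, the number of U's after the (k-1)-th one. *)
Lemma num_avoiding_pattern r u :
  r <= u.+1 ->
  num_avoiding (u + r.+1) (pattern r.+2) =
  \sum_(s < r.+1) ballot r s * nwalks (r.+1 - s) u r.
Proof.
move=> le_ru; rewrite num_avoidingE /pattern subn1 /=.
rewrite -[X in walks _ 0 _ X]add0n walks_avoid_nseqU.
apply: eq_bigr => s _; rewrite -ballotE walks_avoid_nseqD //.
by have := ltn_ord s; lia.
Qed.

Lemma num_avoiding_patternD r u :
  r <= u ->
  num_avoiding (u + r.+1) (pattern r.+2) +
    \sum_(2 <= s < r.+1) ballot r s *
      (\sum_(0 <= i < (s - 2).+1)
        ballot (r - 1 - i) (s - 2 - i)
          * 'C(u + r.+1 + 3 + 2 * i - (r.+2 + s), i)) =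
  'C(u + r, r) * catalan r.+1.
Proof.
move=> le_ru; rewrite num_avoiding_pattern 1?ltnW //.
rewrite -ballot_catalan -(sum_ballot r r) // big_distrr /=.
have sumE s : s <= r ->
    \sum_(j < u.+1) ballot (r.+1 - s + j) j * completions (r.+1 - s) u r j =
    \sum_(0 <= i < s - 1)
        ballot (r - 1 - i) (s - 2 - i)
          * 'C(u + r.+1 + 3 + 2 * i - (r.+2 + s), i).
  move=> le_sr.
  rewrite -(big_mkord xpredT (fun j =>
    ballot (r.+1 - s + j) j * completions (r.+1 - s) u r j)).
  (* A passage from height [r.+1 - s] uses [r.+1 - s + j + 1] of the [r] D's, which forces
     [j <= s - 2]. *)
  rewrite (@big_cat_nat _ _ _ (s - 1)) //=; last by lia.
  rewrite [X in _ + X]big_nat_cond [X in _ + X]big1 => [|j]; last first.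
    rewrite andbT /completions => /andP[ge_j _].
    by case: ltnP; [lia | rewrite muln0].
  (* The reversed index [i = s - 2 - j] is the number of D's left after the first passage; [bin_sub]
     then chooses their places instead of those of the U's. *)
  rewrite addn0 big_nat_rev; apply: eq_big_nat => i /= lt_i.
  rewrite /completions add0n; have -> : s - 1 - i.+1 = s - 2 - i by lia.
  have -> : r.+1 - s + (s - 2 - i) = r - 1 - i by lia.
  have -> : r - 1 - i < r by lia.
  by rewrite mul1n -[in RHS]bin_sub; [congr (_ * 'C(_, _)); lia | lia].
rewrite big_geq_mkord [X in _ + X]big_mkcond -big_split.
apply: eq_bigr => s _ /=.
have le_sr : s <= r by rewrite -ltnS.
rewrite [RHS]mulnC -[X in 'C(_, X)](addKn u) bin_sub ?leq_addr //.
rewrite (bin_nwalks (r.+1 - s)) sumE // mulnDr; congr (_ + _).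
(* For [s <= 1] the starting height is at least [r], and [r] D's cannot lead below 0. *)
case: (ltnP 1 s) => [gt_s1|le_s1]; first by rewrite -subSn // subSS.
by rewrite big_geq ?muln0 // leq_subLR.
Qed.

Local Open Scope ring_scope.

Theorem mainTheorem6 (k n : nat) (hk : (2 <= k)%N) (hn : (2 * k - 3 <= n)%N) :
  (num_avoiding n (pattern k))%:Z =
  ('C(n - 1, k - 2) * catalan (k - 1))%N%:Z
  - (\sum_(2 <= s < (k - 2).+1)
       ballot (k - 2) s *
       (\sum_(0 <= i < (s - 2).+1)
          ballot (k - 3 - i) (s - 2 - i)
          * 'C(n + 3 + 2 * i - (k + s), i)))%N%:Z :> int.
Proof.
have [r def_k] : exists r, k = r.+2 by exists (k - 2)%N; lia.
have [u def_n] : exists u, n = (u + r.+1)%N by exists (n - r.+1)%N; lia.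
(* In these variables [hn] reads [2 * r + 1 <= u + r + 1]. *)
have le_ru : (r <= u)%N by lia.
rewrite def_k def_n !subSS !subn0 addnS subn1 /= -num_avoiding_patternD //.
by rewrite PoszD -[(u + r).+1]addnS GRing.addrK.
Qed.
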